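(* Let $\Gamma$ be a finite $G$-arc-transitive digraph, where $G\leq\mathrm{Aut}(\Gamma)$. Then: (i) if $\Gamma$ has valency at most $5$, then $\Gamma$ is $(G,2)$-geodesic-transitive if and only if $\Gamma$ is $(G,2)$-arc-transitive; (ii) if $\Gamma$ is $(G,2)$-geodesic-transitive of diameter $2$, then $\Gamma$ is a balanced incomplete block design with the Hadamard parameters.
   Context: A digraph $\Gamma$ consists of a finite vertex set $V(\Gamma)$ with an antisymmetric irreflexive relation $\rightarrow$; an arc is an ordered pair $(u,v)$ with $u\rightarrow v$. $\Gamma^+(v)=\{u: v\rightarrow u\}$; a $G$-arc-transitive digraph is regular, and its valency is $|\Gamma^+(v)|$. The distance $d_\Gamma(u,v)$ is the length of a shortest directed path from $u$ to $v$ and the diameter is the maximum distance. An $s$-arc is a sequence $(v_0,\dots,v_s)$ with $v_i\rightarrow v_{i+1}$ for all $i$; it is an $s$-geodesic if $d_\Gamma(v_0,v_s)=s$. $\Gamma$ is $G$-arc-transitive if $G$ is transitive on arcs, $(G,2)$-arc-transitive if $G$ is transitive on $2$-arcs, and $(G,s)$-geodesic-transitive if $G$ is transitive on the set of $i$-geodesics for each $i\leq s$. ''A balanced incomplete block design with the Hadamard parameters'' means: taking the vertices as points and the out-neighbourhoods $\Gamma^+(v)$ as blocks gives a symmetric $2$-$(4t-1,2t-1,t-1)$ design for some integer $t\geq 1$. *)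

(* Defs.v *)
From HB Require Import structures.
From mathcomp Require Import all_boot all_fingroup all_solvable.

Set Implicit Arguments.
Unset Strict Implicit.
Unset Printing Implicit Defensive.

Local Open Scope group_scope.

Record digraph (V : finType) := Digraph {
  arc :> rel V;
  arc_irrefl : irreflexive arc;
  arc_antisym : antisymmetric arc
}.

Section Digraphs.

Variables (V : finType) (Gamma : digraph V).

Definition outnbr (v : V) : {set V} := [set u | Gamma v u].

Definition has_valency (k : nat) : Prop := forall v : V, #|outnbr v| = k.

Definition digraph_aut : {set {perm V}} :=
  [set g : {perm V} | [forall u, forall v, Gamma (g u) (g v) == Gamma u v]].

Definition has_walk (n : nat) (u v : V) : bool :=
  [exists p : n.-tuple V, path Gamma u p && (last u p == v)].

(* The distance is left undefined (infinite) when v is not reachable from u; *)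
(* a walk of minimal length is automatically a path.                         *)
Definition dist_is (u v : V) (d : nat) : bool :=
  has_walk d u v && [forall m : 'I_d, ~~ has_walk m u v].

(* In particular all distances are finite. *)
Definition diameter_is (d : nat) : Prop :=
  (forall u v, exists2 m, dist_is u v m & m <= d) /\
  (exists u v, dist_is u v d).

Definition sarcs (s : nat) : {set s.+1.-tuple V} :=
  [set p : s.+1.-tuple V | sorted Gamma p].

Definition sgeodesics (s : nat) : {set s.+1.-tuple V} :=
  [set p in sarcs s | dist_is (tnth p ord0) (tnth p ord_max) s].

(* 'P * n is the componentwise action of permutations on n-tuples. The       *)
(* library's [transitive _, on S | _] says that S is an orbit, so it also    *)
(* requires S to be nonempty.                                                *)
Definition sarc_transitive (G : {group {perm V}}) (s : nat) : Prop :=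
  [transitive G, on sarcs s | 'P * s.+1].

(* An arc is a 1-arc. *)
Definition arc_transitive (G : {group {perm V}}) : Prop := sarc_transitive G 1.

Definition geodesic_transitive (G : {group {perm V}}) (s : nat) : Prop :=
  forall i : nat, i <= s -> [transitive G, on sgeodesics i | 'P * i.+1].

End Digraphs.

Section Designs.

Variables (T : finType) (B : {set {set T}}).

Definition is_2design (v k lambda : nat) : Prop :=
  [/\ #|T| = v,
      forall b, b \in B -> #|b| = k
    & forall x y : T, x != y ->
        #|[set b in B | (x \in b) && (y \in b)]| = lambda].

Definition is_symmetric_2design (v k lambda : nat) : Prop :=
  is_2design v k lambda /\ #|B| = v.

End Designs.

(* Blocks form a set, so #|B| = v says that distinct vertices have distinct  *)
(* out-neighbourhoods.                                                       *)
Definition hadamard_bibd (V : finType) (Gamma : digraph V) : Prop :=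
  exists2 t : nat, 1 <= t &
    is_symmetric_2design [set outnbr Gamma v | v : V]
      (4 * t - 1)%N (2 * t - 1)%N (t - 1)%N.

(* Main.v *)
(** For an arc [u -> v] of a 2-geodesic-transitive digraph, the stabiliser of
    [u] and [v] is transitive on the out-neighbours of [v] outside those of [u].

    (i) If some 2-arc is not a geodesic, the out-neighbourhood of a vertex
    induces a digraph that is regular of some valency [r >= 1] on [k <= 5]
    vertices, so that [r] is 1 or 2, and an automorphism of such a digraph
    fixing one vertex is the identity.  Hence the stabiliser of [u] and [v]
    fixes every out-neighbour of [u], in particular a common out-neighbour of
    [u] and [v], and so it fixes every out-neighbour of [v]; but it is
    transitive on [k - r >= 2] of these.  Conversely, if every 2-arc were a
    non-geodesic, the arcs would form a strict order on a finite set without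
    maximal elements.

    (ii) The stabiliser of [u] is transitive on the vertices at distance 2 from
    [u], and the in-neighbours of [u] are such vertices.  Hence Gamma is a
    tournament, and arc-transitivity makes it doubly regular. *)

Require Import Defs.
From mathcomp Require Import all_boot all_fingroup all_solvable zify.

Set Implicit Arguments.
Unset Strict Implicit.
Unset Printing Implicit Defensive.

Lemma transitive_n_actP (V : finType) (G : {group {perm V}}) n
    (S : {set n.-tuple V}) (p q : n.-tuple V) :
  [transitive G, on S | 'P * n] -> p \in S -> q \in S ->
  exists2 g : {perm V}, g \in G & map g p = q.
Proof.
move=> trS Sp Sq; have [g Gg ->] := atransP2 trS Sp Sq.
by exists g => //=; apply: eq_map => x; rewrite /= apermE.
Qed.

(** * Neighbourhoods and distances up to 2 *)

Section Digraph.

Variables (V : finType) (Gamma : digraph V).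

Implicit Types (u v w x y : V) (D : {set V}) (g : {perm V}).

Local Notation outn := (outnbr Gamma).

Definition innbr v : {set V} := [set u | Gamma u v].

Lemma in_outnbr u v : (v \in outn u) = Gamma u v.
Proof. by rewrite inE. Qed.

Lemma in_innbr u v : (v \in innbr u) = Gamma v u.
Proof. by rewrite inE. Qed.

Lemma arcF u : Gamma u u = false.
Proof. exact: arc_irrefl. Qed.

Lemma arc_asym u v : Gamma u v -> Gamma v u = false.
Proof.
move=> uv; apply/negP => vu.
have eq_uv : u = v by apply: (@arc_antisym _ Gamma); rewrite uv vu.
by rewrite eq_uv arcF in uv.
Qed.

Lemma autP g : reflect (forall u v, Gamma (g u) (g v) = Gamma u v)
                       (g \in digraph_aut Gamma).
Proof.
rewrite inE; apply: (iffP forallP) => [gP u v | gP u].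
  by apply/eqP; move/forallP: (gP u); apply.
by apply/forallP => v; rewrite gP.
Qed.

Lemma imset_outnbr g v : g \in digraph_aut Gamma -> g @: outn v = outn (g v).
Proof.
move=> /autP gP; apply/setP => x.
by rewrite -(permKV g x) (mem_imset _ _ (@perm_inj _ g)) !in_outnbr gP.
Qed.

Lemma imset_innbr g v : g \in digraph_aut Gamma -> g @: innbr v = innbr (g v).
Proof.
move=> /autP gP; apply/setP => x.
by rewrite -(permKV g x) (mem_imset _ _ (@perm_inj _ g)) !in_innbr gP.
Qed.

Lemma has_walk0 u v : has_walk Gamma 0 u v = (u == v).
Proof.
apply/existsP/idP => [[p]|uv]; first by rewrite tuple0.
by exists [tuple].
Qed.

Lemma has_walk1 u v : has_walk Gamma 1 u v = Gamma u v.
Proof.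
apply/existsP/idP => [[p]|uv]; last by exists [tuple v]; rewrite /= uv eqxx.
by case/tupleP: p => x p; rewrite tuple0 /= andbT => /andP[ux /eqP <-].
Qed.

Lemma has_walk2 u v :
  has_walk Gamma 2 u v = [exists w, Gamma u w && Gamma w v].
Proof.
apply/existsP/existsP => [[p]|[w /andP[uw wv]]]; last first.
  by exists [tuple w; v]; rewrite /= uw wv eqxx.
case/tupleP: p => x p; case/tupleP: p => y p.
rewrite tuple0 /= andbT => /andP[uxy /eqP <-]; by exists x.
Qed.

Lemma dist_is0 u v : dist_is Gamma u v 0 = (u == v).
Proof.
rewrite /dist_is has_walk0; case: eqP => //= _.
by apply/forallP => -[].
Qed.

Lemma dist_is1 u v : dist_is Gamma u v 1 = Gamma u v.
Proof.
rewrite /dist_is has_walk1; case uv: (Gamma u v) => //=.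
apply/forallP => -[[] //= _]; rewrite has_walk0.
by apply/eqP => eq_uv; rewrite eq_uv arcF in uv.
Qed.

(** A walk of length 2 cannot close up, by antisymmetry, so among shorter walks only a single arc
    has to be excluded. *)
Lemma dist_is2 u v :
  dist_is Gamma u v 2 =
    [exists w, Gamma u w && Gamma w v] && ~~ Gamma u v.
Proof.
rewrite /dist_is has_walk2; case: existsP => //= -[w /andP[uw wv]].
apply/forallP/idP => [/(_ (@Ordinal 2 1 isT)) | nuv [[|[|[]]] //= _]].
- by rewrite has_walk1.
- rewrite has_walk0; apply/eqP => eq_uv; rewrite -eq_uv in wv.
  by rewrite (arc_asym uw) in wv.
- by rewrite has_walk1.
Qed.

Lemma sgeodesics0 : sgeodesics Gamma 0 = setT.
Proof.
apply/setP => p; rewrite !inE dist_is0 (ord1 ord_max) eqxx andbT.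
by case/tupleP: p => u p; rewrite tuple0.
Qed.

Lemma sgeodesics1 : sgeodesics Gamma 1 = sarcs Gamma 1.
Proof.
apply/setP => p; case/tupleP: p => u p; case/tupleP: p => v p.
rewrite tuple0 !inE /= dist_is1 !(tnth_nth u) /=.
by case: (Gamma u v).
Qed.

Lemma mem_sarcs2 u v w :
  ([tuple u; v; w] \in sarcs Gamma 2) = Gamma u v && Gamma v w.
Proof. by rewrite inE /= andbT. Qed.

Lemma mem_sgeodesics2 u v w :
  ([tuple u; v; w] \in sgeodesics Gamma 2) =
    [&& Gamma u v, Gamma v w & ~~ Gamma u w].
Proof.
rewrite inE mem_sarcs2 dist_is2 !(tnth_nth u) /= -andbA.
case uv: (Gamma u v) => //=; case vw: (Gamma v w) => //=.
by have -> : [exists x, Gamma u x && Gamma x w]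
  by apply/existsP; exists v; rewrite uv vw.
Qed.

Lemma diameter2P u v :
  diameter_is Gamma 2 ->
  [|| u == v, Gamma u v | [exists w, Gamma u w && Gamma w v] && ~~ Gamma u v].
Proof.
case=> /(_ u v)[m + m_le2] _; case: m m_le2 => [|[|[|//]]] _.
- by rewrite dist_is0 => ->.
- by rewrite dist_is1 => ->; rewrite orbT.
- by rewrite dist_is2 => ->; rewrite !orbT.
Qed.

(** * Counting in induced subdigraphs *)

Lemma card_neighbours D x : x \in D ->
  #|D| = (1 + #|D :&: outn x| + #|D :&: innbr x|
          + #|[set y in D | [&& y != x, ~~ Gamma x y & ~~ Gamma y x]]|)%N.
Proof.
move=> Dx; rewrite (cardsD1 x) Dx -!addnA; congr (_ + _)%N.
rewrite -(cardsID (outn x)) -(cardsID (innbr x) (_ :\: outn x)).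
congr (_ + (_ + _))%N; apply: eq_card => y; rewrite !inE.
- by case: eqP => // ->; rewrite arcF !andbF.
- case: eqP => [->|_]; first by rewrite arcF !andbF.
  by case yx: (Gamma y x); rewrite ?andbF // (arc_asym yx) /= ?andbT.
- by case: (y \in D); case: eqP; case: (Gamma x y); case: (Gamma y x).
Qed.

(** The arcs inside [D] are counted once by their tails and once by their heads. *)
Lemma induced_regular D r s :
  0 < #|D| -> {in D, forall x, #|D :&: outn x| = r} ->
  {in D, forall x, #|D :&: innbr x| = s} -> r = s.
Proof.
move=> D_gt0 outr ins; apply/eqP; rewrite -(eqn_pmul2l D_gt0); apply/eqP.
have card_sum (P : rel V) x :
    #|[set y in D | P x y]| = (\sum_(y in D) P x y)%N.
  rewrite -sum1_card [LHS]big_mkcond [RHS]big_mkcond; apply: eq_bigr => y _.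
  by rewrite inE; case: (y \in D); case: (P x y).
transitivity (\sum_(x in D) \sum_(y in D) Gamma x y)%N.
  rewrite -sum_nat_const; apply: eq_bigr => x Dx.
  by rewrite -card_sum -(outr x Dx); apply: eq_card => y; rewrite !inE.
rewrite exchange_big /= -sum_nat_const; apply: eq_bigr => x Dx.
rewrite -(card_sum (fun x y => Gamma y x)) -(ins x Dx).
by apply: eq_card => y; rewrite !inE.
Qed.

(** * Rigidity of regular digraphs on at most five vertices *)

Section Rigidity.

Variables (D : {set V}) (g : {perm V}) (r : nat).
Hypotheses (autg : g \in digraph_aut Gamma) (gD : g @: D = D).
Hypotheses (D_le5 : #|D| <= 5) (r_gt0 : 0 < r).
Hypothesis (outr : {in D, forall x, #|D :&: outn x| = r}).
Hypothesis (inr : {in D, forall x, #|D :&: innbr x| = r}).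

Let gDout x : g x = x -> g @: (D :&: outn x) = D :&: outn x.
Proof.
move=> gx; rewrite imsetI ?gD ?imset_outnbr ?gx //.
by move=> ? ? _ _; apply: perm_inj.
Qed.

Let gDin x : g x = x -> g @: (D :&: innbr x) = D :&: innbr x.
Proof.
move=> gx; rewrite imsetI ?gD ?imset_innbr ?gx //.
by move=> ? ? _ _; apply: perm_inj.
Qed.

(** The induced digraph is a union of directed cycles, each of length at least 3, and five vertices
    leave room for only one. Concretely, a fixed vertex with its two neighbours and a moved vertex
    with its two neighbours would be six distinct vertices. *)
Lemma rigid1 x y : r = 1 -> x \in D -> g x = x -> y \in D -> g y = y.
Proof.
move=> r1 Dx gx Dy; apply/eqP/idPn => gy.
have stab1 (S : {set V}) z : #|S| = 1 -> g @: S = S -> z \in S -> g z = z.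
  move=> /eqP/cards1P[a ->] gS /set1P ->.
  by apply/set1P; rewrite -gS imset_f ?set11.
have fixout a b : a \in D -> g a = a -> b \in D -> Gamma a b -> g b = b.
  move=> Da ga Db ab; apply: stab1 (gDout ga) _; first by rewrite outr ?r1.
  by rewrite inE Db in_outnbr.
have fixin a b : a \in D -> g a = a -> b \in D -> Gamma b a -> g b = b.
  move=> Da ga Db ba; apply: stab1 (gDin ga) _; first by rewrite inr ?r1.
  by rewrite inE Db in_innbr.
have nbrs a : a \in D -> exists b c,
    [/\ b \in D, c \in D, Gamma a b & Gamma c a].
  move=> Da; have := outr Da; have := inr Da.
  rewrite r1 => /eqP/cards1P[c cE] /eqP/cards1P[b bE]; exists b, c.
  have /setIP[-> ] : b \in D :&: outn a by rewrite bE set11.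
  have /setIP[-> ] : c \in D :&: innbr a by rewrite cE set11.
  by rewrite in_innbr in_outnbr.
have [a [b [Da Db xa bx]]] := nbrs x Dx.
have [c [d [Dc Dd yc dy]]] := nbrs y Dy.
have ga := fixout _ _ Dx gx Da xa; have gb := fixin _ _ Dx gx Db bx.
(* If a neighbour of [y] were fixed, [y] would be its only neighbour in the opposite direction,
   hence fixed too. *)
have gc : g c != c by apply: contra gy => /eqP gc; rewrite (fixin c y).
have gd : g d != d by apply: contra gy => /eqP gd; rewrite (fixout d y).
have neq_arc p q : Gamma p q -> p != q.
  by move=> pq; apply/eqP => eq_pq; rewrite eq_pq arcF in pq.
have neq_path p q s : Gamma p q -> Gamma s p -> q != s.
  by move=> pq sp; apply/eqP => eq_qs; rewrite eq_qs (arc_asym sp) in pq.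
have neq_fix p q : g p = p -> g q != q -> p != q.
  by move=> gp; apply: contra => /eqP <-; rewrite gp.
suff D_ge6 : 6 <= #|D| by have := leq_trans D_ge6 D_le5.
have uniq6 : uniq [:: x; a; b; y; c; d].
  rewrite /= !inE !negb_or.
  rewrite (neq_arc x a xa) (eq_sym x b) (neq_arc b x bx) (neq_path x a b xa bx).
  rewrite (neq_arc y c yc) (eq_sym y d) (neq_arc d y dy) (neq_path y c d yc dy).
  by rewrite (neq_fix x y) // (neq_fix x c) // (neq_fix x d) // (neq_fix a y) //
    (neq_fix a c) // (neq_fix a d) // (neq_fix b y) // (neq_fix b c) // neq_fix.
rewrite (cardE D) (uniq_leq_size uniq6) // => z.
by rewrite !inE mem_enum; do 5?[case/orP]; move/eqP->.
Qed.

(** Here [D] induces a tournament on five vertices, so [y] lies in one of the two pairs of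
    neighbours of [x]. Each pair is stable under [g], and [g] cannot swap its members without
    reversing the arc between them. *)
Lemma rigid2 x y : r = 2 -> x \in D -> g x = x -> y \in D -> g y = y.
Proof.
move=> r2 Dx gx Dy; have [-> // | yx] := eqVneq y x.
(* The vertex [a] with its two out-neighbours and two in-neighbours already exhausts [D]. *)
have adj a b : a \in D -> b \in D -> b != a -> Gamma a b || Gamma b a.
  move=> Da Db ba; have := card_neighbours Da; rewrite outr // inr // r2 => cD.
  have /eqP : #|[set z in D | [&& z != a, ~~ Gamma a z & ~~ Gamma z a]]| = 0.
    by move: D_le5; lia.
  rewrite cards_eq0 => /eqP/setP/(_ b); rewrite !inE Db ba /=.
  by case: (Gamma a b) (Gamma b a) => -[].
have stab2 (S : {set V}) : #|S| = 2 -> g @: S = S -> S \subset D ->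
    y \in S -> g y = y.
  move=> S2 gS sSD Sy; apply/eqP/idPn => gy.
  have Sg z : z \in S -> g z \in S by move=> Sz; rewrite -gS imset_f.
  have ES : S = [set y; g y].
    apply/esym/eqP; rewrite eqEcard S2 cards2 eq_sym gy andbT.
    by rewrite subUset !sub1set Sy Sg.
  have ggy : g (g y) = y.
    have := Sg _ (Sg _ Sy); rewrite {1}ES !inE (inj_eq (@perm_inj _ g)).
    by rewrite (negPf gy) orbF => /eqP.
  have eqg : Gamma (g y) y = Gamma y (g y).
    by rewrite -{2}ggy (autP _ autg) ?ggy.
  have := adj y (g y) Dy (subsetP sSD _ (Sg _ Sy)) gy.
  by rewrite eqg orbb => /[dup] /arc_asym; rewrite eqg => ->.
case/orP: (adj x y Dx Dy yx) => [xy | xy].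
- by apply: stab2 (gDout gx) _ _; rewrite ?outr ?subsetIl // inE Dy in_outnbr.
- by apply: stab2 (gDin gx) _ _; rewrite ?inr ?subsetIl // inE Dy in_innbr.
Qed.

Lemma rigid_le5 x y : x \in D -> g x = x -> y \in D -> g y = y.
Proof.
move=> Dx; have := card_neighbours Dx; rewrite outr // inr // => cD.
(* The count [cD] gives [1 + 2r <= 5]. *)
have [r1|r2] : r = 1 \/ r = 2 by move: r_gt0 D_le5; lia.
- exact: rigid1.
- exact: rigid2.
Qed.

End Rigidity.

(** * Consequences of transitivity on arcs and geodesics *)

Section ArcTransitive.

Variable G : {group {perm V}}.
Hypothesis autG : G \subset digraph_aut Gamma.
Hypothesis arcG : arc_transitive Gamma G.

Lemma arc_transP u v x y : Gamma u v -> Gamma x y ->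
  exists2 g, g \in G & g u = x /\ g v = y.
Proof.
move=> uv xy.
have in_sarcs a b : Gamma a b -> [tuple a; b] \in sarcs Gamma 1.
  by move=> ab; rewrite inE /= ab.
have [g Gg [<- <-]] := transitive_n_actP arcG (in_sarcs _ _ uv) (in_sarcs _ _ xy).
by exists g.
Qed.

Lemma exists_arc : exists u v, Gamma u v.
Proof.
have /imsetP[p + _] := arcG; case/tupleP: p => u p; case/tupleP: p => v p.
by rewrite inE /= => /andP[uv _]; exists u, v.
Qed.

(** Stated for arbitrary equivariant families so as to cover every combination of [outnbr] and
    [innbr]. *)
Lemma card_arc_const (A B : V -> {set V}) u v x y :
    (forall g z, g \in digraph_aut Gamma -> g @: A z = A (g z)) ->
    (forall g z, g \in digraph_aut Gamma -> g @: B z = B (g z)) ->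
  Gamma u v -> Gamma x y -> #|A u :&: B v| = #|A x :&: B y|.
Proof.
move=> gA gB uv xy; have [g Gg [<- <-]] := arc_transP uv xy.
have autg := subsetP autG g Gg.
rewrite -gA // -gB // -imsetI ?card_imset //; first exact: perm_inj.
by move=> ? ? _ _; apply: perm_inj.
Qed.

Lemma geodesic0_transP u v :
  geodesic_transitive Gamma G 2 -> exists2 g : {perm V}, g \in G & g u = v.
Proof.
move=> /(_ 0 isT); rewrite sgeodesics0 => tr0.
have [g Gg [<-]] := transitive_n_actP tr0 (in_setT [tuple u]) (in_setT [tuple v]).
by exists g.
Qed.

Lemma geodesic2_transP u v w x y z :
    geodesic_transitive Gamma G 2 ->
    Gamma u v -> Gamma v w -> ~~ Gamma u w ->
    Gamma x y -> Gamma y z -> ~~ Gamma x z ->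
  exists2 g, g \in G & [/\ g u = x, g v = y & g w = z].
Proof.
move=> /(_ 2 isT) tr2 uv vw uw xy yz xz.
have gu : [tuple u; v; w] \in sgeodesics Gamma 2.
  by rewrite mem_sgeodesics2 uv vw.
have gx : [tuple x; y; z] \in sgeodesics Gamma 2.
  by rewrite mem_sgeodesics2 xy yz.
by have [g Gg [<- <- <-]] := transitive_n_actP tr2 gu gx; exists g.
Qed.

(** * Comparison of 2-arcs and 2-geodesics *)

Lemma sgeodesics2_eq_sarcs :
  (forall u v w, Gamma u v -> Gamma v w -> ~~ Gamma u w) ->
  sgeodesics Gamma 2 = sarcs Gamma 2.
Proof.
move=> no_tri; apply/setP => p.
case/tupleP: p => u p; case/tupleP: p => v p; case/tupleP: p => w p.
rewrite tuple0 mem_sgeodesics2 mem_sarcs2.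
case uv: (Gamma u v) => //=; case vw: (Gamma v w) => //=.
exact: no_tri uv vw.
Qed.

(** Take [u] with fewest out-neighbours and an arc from [u] to [v]: transitivity would put the
    out-neighbourhood of [v] properly inside that of [u], as it misses [v]. *)
Lemma not_trans_of_outnbr :
  (forall u, exists v, Gamma u v) -> ~ transitive Gamma.
Proof.
have [u0 _] := exists_arc; move=> out trG.
have [u _ umin] := @arg_minnP _ u0 xpredT (fun u => #|outn u|) isT.
have [v uv] := out u; have := umin v isT; rewrite leqNgt => /negP; apply.
apply: proper_card; apply/properP; split.
  by apply/subsetP => w; rewrite !in_outnbr; apply: trG uv.
by exists v; rewrite in_outnbr // arcF.
Qed.

Lemma vertex_trans :
  (forall u, exists v, Gamma u v) ->
  [transitive G, on sgeodesics Gamma 0 | 'P * 1].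
Proof.
move=> out; rewrite sgeodesics0; have [u0 _] := exists_arc.
apply/imsetP; exists [tuple u0] => //; apply/esym/setP => p; rewrite inE.
case/tupleP: p => u p; rewrite tuple0.
have [v0 u0v0] := out u0; have [v uv] := out u.
have [g Gg [gu _]] := arc_transP u0v0 uv.
by apply/orbitP; exists g => //; apply: val_inj; rewrite /= apermE gu.
Qed.

Lemma geodesic_of_arc_trans :
  (forall u, exists v, Gamma u v) ->
  sarc_transitive Gamma G 2 -> geodesic_transitive Gamma G 2.
Proof.
move=> out tr2 [|[|[|//]]] _; first exact: vertex_trans.
  by rewrite sgeodesics1.
rewrite sgeodesics2_eq_sarcs // => u v w uv vw; apply/negP => uw.
(* One 2-arc whose ends are joined by an arc can be moved onto any other 2-arc, which would make the
   arc relation transitive. *)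
apply: (not_trans_of_outnbr out) => y x z xy yz.
have arcs a b c : Gamma a b -> Gamma b c -> [tuple a; b; c] \in sarcs Gamma 2.
  by rewrite mem_sarcs2 => -> ->.
have [g Gg [<- _ <-]] := transitive_n_actP tr2 (arcs _ _ _ uv vw) (arcs _ _ _ xy yz).
by rewrite (autP _ (subsetP autG g Gg)).
Qed.

Lemma geodesic_no_triangle k u v w :
    has_valency Gamma k -> k <= 5 -> geodesic_transitive Gamma G 2 ->
  Gamma u v -> Gamma v w -> ~~ Gamma u w.
Proof.
move=> valk k_le5 geo uv vw; apply/negP => uw.
pose r := #|outn u :&: outn v|; pose s := #|outn u :&: innbr v|.
have outr x : {in outn x, forall y, #|outn x :&: outn y| = r}.
  move=> y; rewrite in_outnbr => xy.
  by apply: card_arc_const => // *; apply: imset_outnbr.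
have ins x : {in outn x, forall y, #|outn x :&: innbr y| = s}.
  move=> y; rewrite in_outnbr => xy; apply: card_arc_const => // *.
    exact: imset_outnbr.
  exact: imset_innbr.
have eq_rs : r = s.
  apply: (@induced_regular (outn u)) => //.
  by apply/card_gt0P; exists v; rewrite in_outnbr.
have r_gt0 : 0 < r.
  by apply/card_gt0P; exists w; rewrite inE !in_outnbr uw vw.
have rigid g x y z : g \in G -> g x = x -> Gamma x y -> g y = y ->
    Gamma x z -> g z = z.
  move=> Gg gx xy gy xz; have autg := subsetP autG g Gg.
  apply: (@rigid_le5 (outn x) g r autg _ _ _ _ _ y); rewrite ?in_outnbr //.
  - by rewrite imset_outnbr ?gx.
  - by rewrite valk.
  - by rewrite eq_rs.
(* Counting around [v] inside [outn u] gives [k >= 1 + 2r], so at least [k - r >= 1 + r >= 2]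
   vertices remain. *)
have : 1 < #|outn v :\: outn u|.
  have Dv : v \in outn u by rewrite in_outnbr.
  have := card_neighbours Dv; rewrite outr // ins // -eq_rs.
  have := cardsID (outn u) (outn v).
  rewrite setIC -/r !valk; move: r_gt0; lia.
case/card_gt1P => a [b [+ + neq_ab]]; rewrite 2!in_setD !in_outnbr.
move=> /andP[ua va] /andP[ub vb].
have [g Gg [gu gv ga]] := geodesic2_transP geo uv va ua uv vb ub.
(* Rigidity is used twice: in [outn u], where [v] is fixed, it fixes [w]; then in [outn v], where
   [w] is fixed, it fixes [a], although [g] maps [a] to [b]. *)
have gw := rigid g u v w Gg gu uv gv uw.
by rewrite -ga (rigid g v w a Gg gv vw gw va) eqxx in neq_ab.
Qed.

(** * Diameter 2: doubly regular tournaments *)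

Lemma diameter2_tournament u v :
    geodesic_transitive Gamma G 2 -> diameter_is Gamma 2 ->
  u != v -> Gamma u v || Gamma v u.
Proof.
move=> geo diam neq_uv; have [x0 [u0 x0u0]] := exists_arc.
have [g Gg gu] := geodesic0_transP u0 u geo.
have xu : Gamma (g x0) u.
  by rewrite -gu (autP _ (subsetP autG g Gg)).
have := diameter2P u v diam; rewrite (negPf neq_uv) /=.
case uv: (Gamma u v) => //=; rewrite andbT => /existsP[w /andP[uw wv]].
(* The in-neighbour [g x0] of [u] is at distance 2 from [u], as [v] is. An element of [G] fixing [u]
   and taking [g x0] to [v] carries the arc from [g x0] to [u] onto one from [v] to [u]. *)
have := diameter2P u (g x0) diam.
rewrite (arc_asym xu) (_ : u == g x0 = false) /= ?andbT; last first.
  by apply/eqP => eq_ux; rewrite -eq_ux arcF in xu.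
case/existsP=> y /andP[uy yx].
have [h Gh [hu _ <-]] : exists2 h, h \in G &
    [/\ h u = u, h y = w & h (g x0) = v].
  by apply: geodesic2_transP; rewrite ?uv ?(arc_asym xu).
by rewrite -hu (autP _ (subsetP autG h Gh)).
Qed.

Lemma diameter2_hadamard :
  geodesic_transitive Gamma G 2 -> diameter_is Gamma 2 -> hadamard_bibd Gamma.
Proof.
move=> geo diam.
have tour u v : u != v -> Gamma u v || Gamma v u.
  exact: diameter2_tournament.
have [u0 [v0 u0v0]] := exists_arc.
pose k := #|outn u0|; pose k' := #|innbr u0|; pose l := #|innbr u0 :&: innbr v0|.
have outk u : #|outn u| = k.
  have [g Gg <-] := geodesic0_transP u0 u geo; have autg := subsetP autG g Gg.
  by rewrite -imset_outnbr // card_imset //; apply: perm_inj.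
have ink' u : #|innbr u| = k'.
  have [g Gg <-] := geodesic0_transP u0 u geo; have autg := subsetP autG g Gg.
  by rewrite -imset_innbr // card_imset //; apply: perm_inj.
have inl_arc u v : Gamma u v -> #|innbr u :&: innbr v| = l.
  by move=> uv; apply: card_arc_const => // *; apply: imset_innbr.
have inl u v : u != v -> #|innbr u :&: innbr v| = l.
  by move/tour=> /orP[|vu]; [exact: inl_arc | rewrite setIC inl_arc].
have card_tour (D : {set V}) x : x \in D ->
    #|D| = (1 + #|D :&: outn x| + #|D :&: innbr x|)%N.
  move=> Dx; rewrite {1}(card_neighbours Dx).
  rewrite (_ : [set y in D | _] = set0) ?cards0 ?addn0 //.
  apply/setP => y; rewrite !inE; case: eqVneq => [|neq_yx]; first by rewrite andbF.
  by case/orP: (tour _ _ neq_yx) => ->; rewrite ?andbF.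
have eq_kk' : k = k'.
  apply: (@induced_regular setT) => [|x _|x _]; rewrite ?setTI //.
  by apply/card_gt0P; exists u0.
have cardV : #|V| = (1 + k + k)%N.
  by rewrite -cardsT (card_tour _ u0) ?inE // !setTI outk ink' -eq_kk'.
(* The in-neighbourhood of [v0] induces a tournament on [k] vertices with all in-degrees [l], hence
   all out-degrees [k - l - 1]; double counting equates the two. *)
have cardk : k = (1 + l + l)%N.
  have D_gt0 : 0 < #|innbr v0| by apply/card_gt0P; exists u0; rewrite in_innbr.
  have neq x : x \in innbr v0 -> x != v0.
    by rewrite in_innbr; apply: contraTneq => ->; rewrite arcF.
  have inD : {in innbr v0, forall x, #|innbr v0 :&: innbr x| = l}.
    by move=> x Dx; rewrite setIC inl ?neq.
  have outD : {in innbr v0, forall x, #|innbr v0 :&: outn x| = k - l - 1}.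
    move=> x Dx; have := card_tour _ _ Dx; rewrite ink' -eq_kk' inD //; lia.
  have eq_l := induced_regular D_gt0 outD inD.
  have Du0 : u0 \in innbr v0 by rewrite in_innbr.
  by have := card_tour _ _ Du0; rewrite ink' -eq_kk' inD // outD // eq_l.
have out_inj : injective outn.
  move=> x y /setP eq_xy; apply/eqP/idPn => neq_xy.
  case/orP: (tour _ _ neq_xy); rewrite -in_outnbr.
    by rewrite eq_xy in_outnbr arcF.
  by rewrite -eq_xy in_outnbr arcF.
(* With [t = l + 1], [k = 2l + 1] is [2t - 1] and the [2k + 1] vertices number [4t - 1]. *)
exists l.+1 => //; split; last by rewrite card_imset // cardV; lia.
split; first by rewrite cardV; lia.
  by move=> b /imsetP[x _ ->]; rewrite outk; lia.
(* Blocks through [x] and [y] correspond to common in-neighbours of [x] and [y], by injectivity of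
   [outn]. *)
move=> x y neq_xy; rewrite (_ : [set b in _ | _] = outn @: (innbr x :&: innbr y)).
  by rewrite card_imset // inl //; lia.
apply/setP => b; apply/idP/imsetP => [|[z /setIP[zx zy] ->]].
  rewrite inE => /andP[/imsetP[z _ ->]]; rewrite !in_outnbr => /andP[zx zy].
  by exists z; rewrite // inE !in_innbr zx.
by rewrite inE imset_f //= !in_outnbr -!in_innbr zx.
Qed.

End ArcTransitive.

End Digraph.

Theorem theorem1p5 (V : finType) (Gamma : digraph V) (G : {group {perm V}}) :
  G \subset digraph_aut Gamma ->
  arc_transitive Gamma G ->
  (forall k : nat, has_valency Gamma k -> k <= 5 ->
     (geodesic_transitive Gamma G 2 <-> sarc_transitive Gamma G 2)) /\
  (geodesic_transitive Gamma G 2 -> diameter_is Gamma 2 ->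
     hadamard_bibd Gamma).
Proof.
move=> autG arcG; split=> [k valk k_le5|]; last exact: diameter2_hadamard.
split=> [geo|].
  have := geo 2 isT; rewrite sgeodesics2_eq_sarcs // => u v w.
  exact: (geodesic_no_triangle autG arcG valk).
apply: geodesic_of_arc_trans => // u.
have [u0 [v0 u0v0]] := exists_arc arcG.
have /card_gt0P[v] : 0 < #|outnbr Gamma u|.
  by rewrite valk -(valk u0); apply/card_gt0P; exists v0; rewrite inE.
by rewrite inE; exists v.
Qed.
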